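(* Let $S=S(\lambda_1,\ldots,\lambda_d)$ be a spider with $n=1+\lambda_1+\cdots+\lambda_d$ vertices and $d\ge 5$ legs. If $S$ is $e$-positive, then $$\sum_{k=1}^{d-3}\left(\frac{n}{2}\right)^{-1/2^{k}}<1 .$$
   Context: A spider $S(\lambda_1,\ldots,\lambda_d)$, for positive integers $\lambda_1\ge\cdots\ge\lambda_d$, is the tree consisting of a vertex $v$ (the center) together with $d$ vertex-disjoint paths (legs) having $\lambda_1,\ldots,\lambda_d$ vertices respectively, where $v$ is joined by an edge to one endpoint of each leg. The chromatic symmetric function of a graph $G$ is $X_G=\sum_\kappa \prod_{v} x_{\kappa(v)}$ over proper colorings $\kappa:V(G)\to\{1,2,\dots\}$; $G$ is $e$-positive if $X_G$ is a nonnegative linear combination of elementary symmetric functions $e_\lambda$. *)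

(* Defs.v *)
From Stdlib Require Import Reals.
From HB Require Import structures.
From mathcomp Require Import all_boot all_order all_algebra.
From mathcomp Require Import mpoly.

Set Implicit Arguments.
Unset Strict Implicit.
Unset Printing Implicit Defensive.

Import GRing.Theory Num.Theory.

(* Vertex type of S(l_1,...,l_d) for l = [:: l_1; ...; l_d]:
   None is the center; Some (Tagged i j) is the j-th vertex (j = 0 is the
   endpoint adjacent to the center) of leg i, which has l_i vertices. *)
Definition spider_vertex (l : seq nat) : finType :=
  option {i : 'I_(size l) & 'I_(nth 0 l i)}.

Definition spider_adj0 (l : seq nat) (u v : spider_vertex l) : bool :=
  match u, v with
  | None, Some w => val (tagged w) == 0
  | Some w1, Some w2 => (tag w1 == tag w2) && (val (tagged w2) == (val (tagged w1)).+1)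
  | _, _ => false
  end.

Definition spider_adj (l : seq nat) : rel (spider_vertex l) :=
  fun u v => spider_adj0 u v || spider_adj0 v u.

Definition proper_col (V : finType) (e : rel V) (N : nat) (f : {ffun V -> 'I_N}) : bool :=
  [forall x, forall y, e x y ==> (f x != f y)].

Definition chrom_sym (V : finType) (e : rel V) (N : nat) : {mpoly rat[N]} :=
  \sum_(f : {ffun V -> 'I_N} | proper_col e f) \prod_(v : V) 'X_(f v).

Definition elem_sym (N : nat) (la : seq nat) : {mpoly rat[N]} :=
  \prod_(i <- la) mesym N rat i.

(* G is e-positive: X_G is a nonnegative linear combination of e_lambda's.
   X_G is homogeneous of degree |V|, and in N = |V| variables the e_lambda
   (lambda |- |V|) are linearly independent, so testing in |V| variables is
   faithful. *)
Definition e_positive (V : finType) (e : rel V) : Prop :=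
  exists (P : seq (seq nat)) (c : seq nat -> rat),
    (forall la, la \in P -> 0 <= c la)%R /\
    (chrom_sym e #|V| = \sum_(la <- P) c la *: elem_sym #|V| la)%R.

Definition spider_lhs (n d : nat) : R :=
  \big[Rplus/R0]_(1 <= k < d - 2)
     Rpower (Rdiv (INR n) (INR 2)) (Ropp (Rinv (pow (INR 2) k))).

(* Main.v *)
(* Write [n = 2 N] and let [l_1 >= ... >= l_d] be the legs.  An [e]-positive
   spider has connected partitions of every type [mu] of size [n] (Wolfgang).
   A block with at least [m] vertices cannot lie inside a leg with fewer than
   [m] vertices, so if all parts of [mu] are at least [m] then the block of the
   center contains all such legs.  For [m = l_1 + 1] this gives
   [n <= 2 l_1 + 1]; for [m = l_p + 1], [2 <= p <= d - 2], and parts in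
   [[m, m + l_(p+1)]], it shows that [n] is not a sum of such parts, whence
   [N l_(p+1) < l_p ^ 2].  By induction [l_(d-1-k) >= N ^ (1 - 1 / 2 ^ k)], and
   the sum of these legs is less than [N].

   Wolfgang's theorem is proved by specializing, for each part [m] of [mu],
   [m] of the variables to [om z ^ j t] with [z] a primitive [m]-th root of
   unity and extracting the coefficient of the product of the [t ^ m].  This
   coefficient is nonnegative on every [e_la] and equals 1 on [e_n].  On the
   chromatic symmetric function it sums the weights of colourings, and those
   inducing a disconnected block cancel, as turning the colours on a component
   multiplies the weight by a nontrivial root of unity. *)

Require Import Defs.
From Stdlib Require Import Reals Lra.
From mathcomp Require Import all_boot all_order all_algebra.
From mathcomp Require Import all_field mpoly zify.

Set Implicit Arguments.
Unset Strict Implicit.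
Unset Printing Implicit Defensive.

Import Order.TTheory GRing.Theory Num.Theory.

Local Open Scope ring_scope.

(** * Products over roots of unity *)

Lemma prod_1_root_unity (m : nat) (z om : algC) :
  (0 < m)%N -> m.-primitive_root z -> om ^+ m = (-1) ^+ m.-1 ->
  \prod_(j < m) (1 + (om * z ^+ j) *: 'X) = 1 + 'X^m :> {poly algC}.
Proof.
(* [X ^ m - 1] is factored over the powers of [z^-1] and [q] is substituted for [X]; the leftover
   scalar [K] is found by evaluating at 0. *)
move=> m_gt0 prz omE; pose q : {poly algC} := (- om) *: 'X.
have z0 : z != 0.
  by apply/eqP=> z0; move: (prim_expr_order prz); rewrite z0 expr0n gtn_eqF //;
     move/eqP; rewrite eq_sym oner_eq0.
have prz' : m.-primitive_root z^-1.
  have -> : z^-1 = z ^+ m.-1.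
    by apply: (mulfI z0); rewrite mulfV // -exprS prednK // (prim_expr_order prz).
  by rewrite prim_root_exp_coprime // coprimePn.
pose K := \prod_(j < m) (- (z ^+ j)^-1).
set P := \prod_(j < m) _.
have defP : K *: P = (- om) ^+ m *: 'X^m - 1.
  have := congr1 (comp_poly q) (factor_Xn_sub_1 prz').
  rewrite big_mkord rmorph_prod /= rmorphB rmorph1 rmorphXn /= comp_polyX exprZn.
  move=> <-; rewrite /K /P -scaler_prod; apply: eq_bigr => j _.
  rewrite comp_polyB comp_polyX comp_polyC /q scalerDr scalerA mulNr mulrCA mulVf ?expf_neq0 //.
  by rewrite mulr1 addrC -(alg_polyC (z^-1 ^+ j)) !scaleNr exprVn.
have K1 : K = -1.
  have := congr1 (fun p : {poly algC} => p.[0]) defP.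
  rewrite hornerZ horner_prod big1 => [|j _]; last by rewrite !hornerE ?mulr0 ?addr0.
  by rewrite mulr1 => ->; rewrite !hornerE expr0n gtn_eqF // mulr0 add0r.
move: defP; rewrite K1 scaleN1r => /(congr1 -%R); rewrite opprK => ->.
have -> : (- om) ^+ m = -1.
  by rewrite exprNn omE -{1}(prednK m_gt0) exprS mulN1r mulNr -expr2 sqrr_sign.
by rewrite scaleN1r opprB opprK.
Qed.

(** * Specialization of symmetric functions at roots of unity *)

Section RootSpecialization.

Variables (k : nat) (mu : 'I_k -> nat).
Hypothesis mu_gt0 : forall i, (0 < mu i)%N.

Definition color : finType := {i : 'I_k & 'I_(mu i)}.

Lemma card_color : #|color| = (\sum_i mu i)%N.
Proof.
rewrite card_tagged sumnE big_map big_enum /=.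
by apply: eq_bigr => i _; rewrite card_ord.
Qed.

Definition zeta (i : 'I_k) : algC := sval (C_prim_root_exists (mu_gt0 i)).

Lemma zetaP i : (mu i).-primitive_root (zeta i).
Proof. exact: svalP (C_prim_root_exists (mu_gt0 i)). Qed.

(* The sign is chosen so that [prod_1_root_unity] yields [1 + 'X^m], which makes
   every [ev (mesym N rat r)] a sum of monomials. *)
Definition om (i : 'I_k) : algC := (mu i).-root ((-1) ^+ (mu i).-1).

Lemma om_neq0 i : om i != 0.
Proof. by rewrite /om rootC_eq0 // signr_eq0. Qed.

Definition weight (c : color) : algC := om (tag c) * zeta (tag c) ^+ tagged c.

Local Notation T := {mpoly algC[k]}.

Definition xval (c : color) : T := (weight c)%:MP * 'X_(tag c).

Definition mon : 'X_{1..k} := [multinom mu i | i < k].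

(** Generating polynomial of the specialized elementary symmetric functions. In class [i],
    [prod_1_root_unity] is evaluated at ['X_i] times the variable. *)
Lemma prod_gen : \prod_(c : color) (1 + (xval c)%:P * 'X) =
  \prod_(i < k) (1 + ('X_i ^+ mu i)%:P * 'X^(mu i)) :> {poly T}.
Proof.
rewrite -(sig_big_dep (fun _ => true) (fun _ _ => true)
  (fun i (j : 'I_(mu i)) => 1 + (xval (Tagged (fun i => 'I_(mu i)) j))%:P * 'X)) /=.
apply: eq_bigr => i _.
pose f : {rmorphism algC -> {poly T}} := (@polyC T) \o (@mpolyC k algC).
pose y : {poly T} := ('X_i)%:P * 'X.
have omE : om i ^+ mu i = (-1) ^+ (mu i).-1 by rewrite /om rootCK.
have := congr1 (fun p => (map_poly f p).[y])
  (prod_1_root_unity (mu_gt0 i) (zetaP i) omE).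
rewrite rmorph_prod horner_prod rmorphD rmorph1 /= map_polyXn !hornerE.
rewrite {2}/y exprMn -rmorphXn => <-; apply: eq_bigr => j _.
rewrite rmorphD rmorph1 -mul_polyC rmorphM /= map_polyC map_polyX !hornerE /y /xval /weight /=.
by rewrite -rmorphM.
Qed.

Variables (N : nat) (phi : 'I_N -> color) (psi : color -> 'I_N).
Hypotheses (phiK : cancel phi psi) (psiK : cancel psi phi).

Definition coef_emb : {rmorphism rat -> T} := (@mpolyC k algC) \o ratr.
Definition ev : {rmorphism {mpoly rat[N]} -> T} := mmap coef_emb (xval \o phi).

(** Both sides are the coefficient of degree [r] in [prod_gen], expanded over sets of variables on
    the left and over sets of classes on the right. *)
Lemma ev_mesym r : ev (mesym N rat r) =
  \sum_(I : {set 'I_k} | (\sum_(i in I) mu i == r)%N) \prod_(i in I) 'X_i ^+ mu i.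
Proof.
have L : ev (mesym N rat r) = \sum_(h : {set 'I_N} | #|h| == r) \prod_(i in h) xval (phi i).
  rewrite /mesym rmorph_sum; apply: eq_bigr => h _; rewrite rmorph_prod.
  by apply: eq_bigr => i _; rewrite /ev /= mmapX mmap1U.
have P1 (I : finType) (g : I -> T) (d : I -> nat) :
    (\prod_i (1 + (g i)%:P * 'X^(d i)))`_r =
    \sum_(h : {set I} | (\sum_(i in h) d i == r)%N) \prod_(i in h) g i.
  under eq_bigr => i _ do rewrite addrC.
  rewrite bigA_distr coef_sum [RHS]big_mkcond /=; apply: eq_bigr => h _.
  rewrite -big_mkcond /= big_split /= -rmorph_prod /= -expr_sum.
  by rewrite coefCM coefXn eq_sym; case: eqP => _; rewrite ?mulr1 ?mulr0.
have := congr1 (fun p : {poly T} => p`_r) prod_gen.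
rewrite (eq_bigr (fun i => 1 + ('X_i ^+ mu i)%:P * 'X^(mu i))) // P1 => <-.
rewrite L; have := P1 _ (fun i : 'I_N => xval (phi i)) (fun => 1%N).
under [X in _ = X]eq_bigl => h do rewrite sum1_card.
move=> <-; congr ((polyseq _)`_r); rewrite [RHS](reindex phi); first by apply: eq_bigr => c _; rewrite expr1.
by exists psi => ? _; [exact: phiK | exact: psiK].
Qed.
Definition nneg_coef (p : T) := forall m, 0 <= p@_m.

Lemma nneg_coefM p q : nneg_coef p -> nneg_coef q -> nneg_coef (p * q).
Proof.
by move=> p0 q0 m; rewrite mcoeffM; apply: sumr_ge0 => i _; apply: mulr_ge0.
Qed.

Lemma nneg_coefX m : nneg_coef 'X_[m].
Proof. by move=> m'; rewrite mcoeffX ler0n. Qed.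

Lemma nneg_coef_prod (I : Type) (s : seq I) (P : pred I) (F : I -> T) :
  (forall i, nneg_coef (F i)) -> nneg_coef (\prod_(i <- s | P i) F i).
Proof.
move=> F0; apply: (big_ind nneg_coef) => //; last exact: nneg_coefM.
by rewrite -mpolyX0; apply: nneg_coefX.
Qed.

Lemma nneg_ev_elem_sym la : nneg_coef (ev (elem_sym N la)).
Proof.
rewrite rmorph_prod; apply: nneg_coef_prod => r m; rewrite ev_mesym linear_sum /=.
apply: sumr_ge0 => I _; apply: nneg_coef_prod => i m'.
by rewrite mpolyXn; apply: nneg_coefX.
Qed.

Lemma mpolyX_mon : \prod_i 'X_i ^+ mu i = 'X_[mon] :> T.
Proof. by rewrite mpolyXE_id; apply: eq_bigr => i _; rewrite mnmE. Qed.

Lemma sum_mu_lt (I : {set 'I_k}) :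
  I != setT -> (\sum_(i in I) mu i < \sum_i mu i)%N.
Proof.
rewrite -subTset => /subsetPn [i _ iI]; rewrite [X in (_ < X)%N](bigD1 i) //=.
rewrite [X in (_ < _ + X)%N](bigID (mem I)) /=.
rewrite [X in (_ < _ + (X + _))%N](eq_bigl (fun j => j \in I)); last first.
  by move=> j /=; case: eqP => // ->; rewrite (negbTE iI).
by rewrite addnCA -[X in (X < _)%N]addn0 ltn_add2l addn_gt0 mu_gt0.
Qed.

Lemma ev_mesym_top : ev (mesym N rat (\sum_i mu i)) = 'X_[mon].
Proof.
rewrite ev_mesym (bigD1 setT) /=; last first.
  by apply/eqP; apply: eq_bigl => i; rewrite inE.
rewrite [X in _ + X]big1 ?addr0 => [|I /andP[/eqP sI /sum_mu_lt]]; last by rewrite sI ltnn.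
by rewrite -mpolyX_mon; apply: eq_bigl => i; rewrite inE.
Qed.

(** A single class has only the empty and the full set of classes, so no [e_la] outside
    [trivial_type] survives. *)
Lemma ev_mesym_one_part r :
  k = 1%N -> r != 0%N -> r != (\sum_i mu i)%N -> ev (mesym N rat r) = 0.
Proof.
move=> k1 r0 rs; rewrite ev_mesym big1 // => I /eqP rI; exfalso.
have [I0|[i iI]] := set_0Vmem I; first by rewrite -rI I0 big_set0 eqxx in r0.
suff IT : I = setT by rewrite -rI IT (eq_bigl xpredT) ?eqxx // in rs => j; rewrite inE.
apply/setP => j; rewrite inE; suff -> : j = i by [].
by apply/val_inj; move: i j {iI}; rewrite k1 => i j; rewrite !ord1.
Qed.

Definition trivial_type la :=
  all (fun r => (r == 0%N) || (r == \sum_i mu i)%N) la.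

Lemma ev_elem_sym_trivial la : trivial_type la ->
  ev (elem_sym N la) = 'X_[mon] ^+ count_mem (\sum_i mu i)%N (filter (fun r => r != 0)%N la).
Proof.
elim: la => [_|r la IH /= /andP[/orP hr /IH {}IH]].
  by rewrite /elem_sym big_nil rmorph1.
rewrite /elem_sym big_cons rmorphM -/(elem_sym N la) IH.
case: eqVneq hr => [->|r0] hr /=; first by rewrite mesym0E rmorph1 mul1r.
by case: hr => // /eqP->; rewrite eqxx ev_mesym_top exprS.
Qed.

(** * Colourings and their cancellation *)

Section Chromatic.

Variables (V : finType) (e : rel V).
Implicit Type f : {ffun V -> color}.

Definition proper_color f := [forall x, forall y, e x y ==> (f x != f y)].

Definition balanced (g : V -> 'I_k) := [forall i, #|[set v | g v == i]| == mu i].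

(** The exponent of ['X_i] counts the vertices coloured in class [i], so the monomial [mon] selects
    the balanced colourings. *)
Lemma ev_chrom_sym : (ev (chrom_sym e N))@_mon =
  \sum_(f : {ffun V -> color} | proper_color f && balanced (fun v => tag (f v)))
     \prod_v weight (f v).
Proof.
have -> : ev (chrom_sym e N) =
    \sum_(f : {ffun V -> color} | proper_color f) \prod_v xval (f v).
  rewrite rmorph_sum (reindex (fun f : {ffun V -> color} => [ffun v => psi (f v)])) /=.
    apply: eq_big => [f|f _]; last first.
      rewrite rmorph_prod; apply: eq_bigr => v _.
      by rewrite /ev /= mmapX mmap1U /= ffunE psiK.
    apply: eq_forallb => x; apply: eq_forallb => y; rewrite !ffunE.
    by rewrite (can_eq psiK).
  exists (fun f : {ffun V -> 'I_N} => [ffun v => phi (f v)]) => f _;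
    by apply/ffunP => v; rewrite !ffunE ?psiK ?phiK.
rewrite linear_sum big_mkcondr; apply: eq_bigr => f _ /=.
rewrite big_split /= -rmorph_prod mcoeffCM.
rewrite -(big_morph _ (@mpolyXD _ _) (@mpolyX0 _ _)) mcoeffX.
have -> : (\sum_v U_(tag (f v)) == mon)%MM = balanced (fun v => tag (f v)).
  apply/eqP/forallP => [/mnmP E i | E].
    move: (E i); rewrite mnm_sumE mnmE => <-; rewrite -sum1_card big_mkcond /=.
    by apply/eqP/eq_bigr => v _; rewrite inE mnm1E; case: eqP.
  apply/mnmP => i; rewrite mnm_sumE mnmE -(eqP (E i)) -sum1_card [RHS]big_mkcond /=.
  by apply/eq_bigr => v _; rewrite inE mnm1E; case: eqP.
by case: ifP => _; rewrite ?mulr1 ?mulr0.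
Qed.

Definition turn_color (c : color) : color :=
  Tagged (fun i => 'I_(mu i)) (ordS (tagged c)).

Lemma turn_color_inj : injective turn_color.
Proof.
move=> [i a] [j b] /eqP; rewrite -tag_eqE /tag_eq /= => /andP[/eqP ij].
by case: _ / ij b => b; rewrite tagged_asE => /eqP /(bij_inj (ordS_bij _)) ->.
Qed.

Lemma weight_turn_color c : weight (turn_color c) = zeta (tag c) * weight c.
Proof.
rewrite /weight /= (prim_expr_mod (zetaP _)) exprS.
by rewrite mulrCA.
Qed.

Definition turn (A : {set V}) f : {ffun V -> color} :=
  [ffun v => if v \in A then turn_color (f v) else f v].

Lemma tag_turn A f v : tag (turn A f v) = tag (f v).
Proof. by rewrite ffunE; case: ifP. Qed.

Lemma turn_inj A : injective (turn A).
Proof.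
move=> f g /ffunP E; apply/ffunP => v; move: (E v); rewrite !ffunE.
by case: ifP => // _ /turn_color_inj.
Qed.

Lemma turn_eq (A : {set V}) f u v : (u \in A) = (v \in A) -> (turn A f u == turn A f v) = (f u == f v).
Proof. by rewrite !ffunE => ->; case: ifP => // _; rewrite (inj_eq turn_color_inj). Qed.

(* Turning the colours on [A] multiplies every weight by [zeta i ^+ #|A|],
   which differs from 1. *)
Lemma turn_sum0 (A : {set V}) (i : 'I_k) (Q : pred {ffun V -> color}) :
  (0 < #|A| < mu i)%N ->
  (forall f v, Q f -> v \in A -> tag (f v) = i) ->
  (forall f, Q (turn A f) = Q f) ->
  \sum_(f | Q f) \prod_v weight (f v) = 0.
Proof.
case/andP=> A0 Ai Qi Qturn; set S := \sum_(f | _) _.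
have ES : S = zeta i ^+ #|A| * S.
  rewrite {1}/S (reindex_inj (@turn_inj A)) mulr_sumr.
  apply: eq_big => [f|f Qf]; first exact: Qturn.
  rewrite (bigID (mem A)) [in RHS](bigID (mem A)) /= mulrA; congr (_ * _).
    rewrite -prodr_const -big_split /=; apply: eq_bigr => v vA.
    by rewrite ffunE vA weight_turn_color (Qi f) // -Qturn.
  by apply: eq_bigr => v /negbTE vA; rewrite ffunE vA.
apply/eqP; have : (1 - zeta i ^+ #|A|) * S == 0 by rewrite mulrBl mul1r -ES subrr.
rewrite mulf_eq0 subr_eq0 eq_sym -(prim_order_dvd (zetaP i)).
by case/orP=> // /(dvdn_leq A0); rewrite leqNgt Ai.
Qed.

(** For a balanced [g], some block is disconnected: [A] is a nonempty union of components of the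
    block, but not all of it. *)
Definition split_class (g : V -> 'I_k) :=
  exists i (A : {set V}), [/\ (0 < #|A| < mu i)%N, forall v, v \in A -> g v = i &
    forall u v, u \in A -> v \notin A -> g v = i -> ~~ e u v && ~~ e v u].

(** Colourings are grouped by their classes [g]. Turning on [A] preserves properness, since an edge
    leaving [A] joins two different classes. *)
Lemma ev_chrom_sym0 :
  (forall g, balanced g -> split_class g) -> (ev (chrom_sym e N))@_mon = 0.
Proof.
move=> split_all; rewrite ev_chrom_sym.
rewrite (partition_big (fun f : {ffun V -> color} => [ffun v => tag (f v)])
  (fun g : {ffun V -> 'I_k} => balanced g)) /=; last first.
  move=> f /andP[_ /forallP B]; apply/forallP => i; rewrite -(eqP (B i)).
  by apply/eqP; apply: eq_card => v; rewrite !inE ffunE.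
apply: big1 => g /split_all [i [A [szA Ag sepA]]].
apply: (turn_sum0 szA) => [f v /andP[_ /eqP gE] /Ag|f]; first by rewrite -gE ffunE.
have -> : [ffun v => tag (turn A f v)] = [ffun v => tag (f v)].
  by apply/ffunP => v; rewrite [LHS]ffunE [RHS]ffunE tag_turn.
case: eqP => Eg; last by rewrite !andbF.
rewrite !andbT; congr andb; last first.
  apply: eq_forallb => j; congr (_ == _); apply: eq_card => v.
  by rewrite !inE tag_turn.
have gE v : g v = tag (f v) by rewrite -Eg ffunE.
apply: eq_forallb => u; apply: eq_forallb => v.
have [/turn_eq->//|uv] := eqVneq (u \in A) (v \in A).
case euv: (e u v) => //=.
have guv : g u != g v.
  apply: contra_neq uv => guv; case uA : (u \in A); case vA : (v \in A) => //.
    by have := sepA u v uA (negbT vA) (etrans (esym guv) (Ag u uA)); rewrite euv.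
  by have := sepA v u vA (negbT uA) (etrans guv (Ag v vA)); rewrite euv andbF.
have neq_tag (c c' : color) : tag c != tag c' -> c != c' by apply: contra_neq => ->.
by rewrite !neq_tag ?tag_turn -?gE.
Qed.
End Chromatic.
End RootSpecialization.

(** * Connected partitions from [e]-positivity *)

(** Two specializations are compared. The one with a single class is nonzero, which yields some [la]
    with nonzero coefficient and the only nonzero part [n]; under [mu] its term is positive and no
    other is negative. *)
Lemma e_positive_no_split (V : finType) (e : rel V) (V_gt0 : (0 < #|V|)%N)
    (k : nat) (mu : 'I_k -> nat) (mu_gt0 : forall i, (0 < mu i)%N) :
  (\sum_i mu i)%N = #|V| -> e_positive e ->
  (let mu1 (i : 'I_1) := #|V| in
   \sum_(f : {ffun V -> color mu1} |
      proper_color e f && balanced mu1 (fun v => tag (f v)))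
     \prod_v weight (fun=> V_gt0) (f v) != 0) ->
  ~ (forall g, balanced mu g -> split_class mu e g).
Proof.
move=> sum_mu [P [c [c_ge0 XE]]] /= top0 split_all.
have bij k' (nu : 'I_k' -> nat) : (\sum_i nu i)%N = #|V| ->
    exists phi : 'I_#|V| -> color nu, exists2 psi, cancel phi psi & cancel psi phi.
  rewrite -card_color => E; exists (fun i => enum_val (cast_ord (esym E) i)).
  exists (fun x => cast_ord E (enum_rank x)) => x.
    by rewrite enum_valK cast_ordKV.
  by rewrite cast_ordK enum_rankK.
have evX k' nu (nu0 : forall i : 'I_k', (0 < nu i)%N) phi :
    (ev nu0 phi (chrom_sym e #|V|))@_(mon nu) =
    \sum_(la <- P) ratr (c la) * (ev nu0 phi (elem_sym #|V| la))@_(mon nu).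
  rewrite XE rmorph_sum linear_sum /=; apply: eq_bigr => la _.
  by rewrite /ev /= mmapZ /= mcoeffCM.
pose mu1 (i : 'I_1) := #|V|; pose mu10 (i : 'I_1) := V_gt0.
have sum1 : (\sum_i mu1 i)%N = #|V| by rewrite big_ord1.
have [phi1 [psi1 phi1K psi1K]] := bij _ _ sum1.
have [la laP /andP[c0 e0]] : exists2 la, la \in P &
    (c la != 0) && ((ev (mu := mu1) mu10 phi1 (elem_sym #|V| la))@_(mon mu1) != 0).
  apply/hasP; apply: contraNT top0 => /hasPn none.
  rewrite -(ev_chrom_sym mu10 phi1K psi1K) evX big_seq big1 // => la /none.
  by rewrite negb_and !negbK => /orP[] /eqP->; rewrite ?rmorph0 ?mul0r ?mulr0.
have triv : trivial_type mu1 la.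
  apply/allP => r rla; apply: contraNT e0; rewrite negb_or => /andP[r0 rs].
  rewrite /elem_sym (big_rem r) //= rmorphM.
  by rewrite (ev_mesym_one_part _ phi1K psi1K) // mul0r mcoeff0.
(* [e_la] becomes a power of the monomial [mon], which equals [mon] only if the part [n] occurs
   once. *)
have cnt : count_mem #|V| [seq r <- la | r != 0%N] = 1%N.
  move: e0; rewrite (ev_elem_sym_trivial _ phi1K psi1K) // sum1 mpolyXn mcoeffX.
  case: (_ =P mon mu1) => [/(congr1 (fun m : 'X_{1..1} => m ord0)) E _|]; last by rewrite eqxx.
  by move/eqP: E; rewrite mulmnE mnmE /mu1 -{3}[#|V|]muln1 eqn_pmul2l // => /eqP.
have [phi [psi phiK psiK]] := bij _ _ sum_mu.
have /eqP := ev_chrom_sym0 mu_gt0 phiK psiK split_all.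
rewrite evX big_seq psumr_eq0 => [|la' la'P]; last first.
  by rewrite mulr_ge0 ?ler0q ?c_ge0 // (nneg_ev_elem_sym _ phiK psiK).
move/allP/(_ la laP); rewrite laP (ev_elem_sym_trivial _ phiK psiK); last first.
  by move: triv; rewrite /trivial_type sum1 sum_mu.
by rewrite sum_mu cnt expr1 mcoeffX eqxx mulr1 fmorph_eq0 (negbTE c0).
Qed.

(** * Spiders and their connected partitions *)

Section Spider.

Variable l : seq nat.
Local Notation V := (spider_vertex l).

Lemma card_spider_vertex : #|V| = (1 + sumn l)%N.
Proof.
rewrite card_option card_tagged add1n; congr (sumn _).+1.
rewrite -[RHS](mkseq_nth 0%N) /mkseq -val_enum_ord -map_comp.
by apply: eq_map => i /=; rewrite card_ord.
Qed.

Lemma spider_vertex_gt0 : (0 < #|V|)%N.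
Proof. by rewrite card_spider_vertex. Qed.

(** The component away from the center that is cut off by deleting the edge into [w]. *)
Definition subleg (w : {i : 'I_(size l) & 'I_(nth 0%N l i)}) : {set V} :=
  [set x : V | if x is Some w' then (tag w' == tag w) && (tagged w <= tagged w')%N
               else false].

Lemma val_tagged_inj (w1 w2 : {i : 'I_(size l) & 'I_(nth 0%N l i)}) :
  tag w1 = tag w2 -> val (tagged w1) = val (tagged w2) -> w1 = w2.
Proof.
case: w1 w2 => [i a] [j b] /= ij; case: _ / ij b => b ab; congr Tagged.
exact: val_inj.
Qed.

(** Edges are oriented outward and every vertex has at most one predecessor, so only the edge into
    [w] enters [subleg w]. *)
Lemma subleg_edge u w x y : spider_adj0 u (Some w) -> spider_adj0 x y ->
  (x, y) != (u, Some w) -> (x \in subleg w) = (y \in subleg w).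
Proof.
move=> uw xy ne; rewrite !inE.
case: y xy ne => [w2|]; last by case: x.
case: x => [w1|] /= => [/andP[/eqP t12 /eqP v12]|/eqP v2] ne; last first.
  apply/esym/negbTE/negP => /andP[/eqP t2]; rewrite v2 leqn0 => /eqP w0.
  have E : w2 = w by apply: val_tagged_inj => //; apply: etrans v2 (esym w0).
  by move: ne uw; rewrite E; case: u => [w3|]; rewrite ?eqxx /= ?w0 ?andbF.
have -> : (tag w1 == tag w) = (tag w2 == tag w) by rewrite t12.
case: eqP => //= t2; rewrite v12 [in RHS]leq_eqVlt ltnS.
case: eqP => //= w0; exfalso.
have E : w2 = w by apply: val_tagged_inj => //; apply: etrans v12 (esym w0).
move: ne uw; rewrite E; case: u => [w3|] /=; last by rewrite w0.
move=> ne /andP[/eqP t3 /eqP v3]; case/eqP: ne; congr (Some _, _).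
by apply: val_tagged_inj; [rewrite t12 t2 t3 | apply: succn_inj; rewrite -v12 -v3 w0].
Qed.

Lemma card_subleg w : (0 < #|subleg w| < #|V|)%N.
Proof.
apply/andP; split; first by apply/card_gt0P; exists (Some w); rewrite inE eqxx /=.
rewrite -cardsT; apply: proper_card; apply/properP; split; first exact: subsetT.
by exists None; rewrite ?inE.
Qed.

Local Notation mu1 := (fun _ : 'I_1 => #|V|).
Local Notation wt := (weight (mu := mu1) (fun=> spider_vertex_gt0)).
Implicit Type f : {ffun V -> color mu1}.

Lemma tag_color1 (c : color mu1) : tag c = ord0.
Proof. exact: ord1. Qed.

Definition merged (J : {set V * V}) f :=
  [forall p in J, spider_adj0 p.1 p.2 && (f p.1 == f p.2)].

(** Inclusion-exclusion over the edges: [spider_adj0] lists each edge once, and a set [J] with a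
    non-edge is never merged. *)
Lemma proper_spider_sum f : (proper_color (@spider_adj l) f)%:R =
  \sum_(J : {set V * V}) (-1) ^+ #|J| * (merged J f)%:R :> algC.
Proof.
pose b p := spider_adj0 p.1 p.2 && (f p.1 == f p.2).
transitivity (\prod_p (- (b p)%:R + 1 : algC)).
  have [/forallP pr|npr] := boolP (proper_color _ f).
    rewrite big1 // => -[x y] _; rewrite /b /=.
    case: (boolP (spider_adj0 x y)) => [xy|_]; last by rewrite oppr0 add0r.
    have /forallP/(_ y) := pr x; rewrite /spider_adj xy /= => /negbTE->.
    by rewrite oppr0 add0r.
  apply/esym/eqP; apply/prodf_eq0; case: (pickP b) => [p bp|nb].
    by exists p; rewrite // bp addNr.
  case/negP: npr; apply/forallP => x; apply/forallP => y; apply/implyP => /orP[] a.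
    by have := nb (x, y); rewrite /b /= a /= => ->.
  by have := nb (y, x); rewrite /b /= a /= eq_sym => ->.
rewrite bigA_distr; apply: eq_bigr => J _; rewrite -big_mkcond /= prodrN.
congr (_ * _); have [/forall_inP mg|nmg] := boolP (merged J f).
  by rewrite big1 // => p /mg; rewrite /b => ->.
apply/eqP/prodf_eq0; case: (pickP (fun p => (p \in J) && ~~ b p)) => [p /andP[pJ np]|nb].
  by exists p; rewrite // (negbTE np).
by case/negP: nmg; apply/forall_inP => p pJ; have := nb p; rewrite pJ => /negbFE.
Qed.

Lemma merged_all_const f :
  merged [set p | spider_adj0 p.1 p.2] f -> f = [ffun=> f None].
Proof.
move/forall_inP => mg; apply/ffunP => -[[i [j lt_j]]|]; rewrite ffunE //.
elim: j lt_j => [|j IH] lt_j; last rewrite -(IH (ltnW lt_j)).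
all: apply/esym/eqP.
  have /= := mg (None, Some (Tagged (fun i : 'I_(size l) => 'I_(nth 0%N l i)) (Ordinal lt_j))).
  by rewrite inE /= => /(_ isT).
have /= := mg (Some (Tagged (fun i : 'I_(size l) => 'I_(nth 0%N l i)) (Ordinal (ltnW lt_j))),
   Some (Tagged (fun i : 'I_(size l) => 'I_(nth 0%N l i)) (Ordinal lt_j))).
by rewrite inE /= !eqxx => /(_ isT).
Qed.

(** If the edge into [w] is missing from [J], turning [subleg w] respects all equalities along [J],
    and [turn_sum0] applies. *)
Lemma merged_sum0 (J : {set V * V}) : J != [set p | spider_adj0 p.1 p.2] ->
  \sum_(f | merged J f) \prod_v wt (f v) = 0.
Proof.
move=> JE; have [JsE|JnE] := boolP (J \subset [set p | spider_adj0 p.1 p.2]); last first.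
  rewrite big_pred0 // => f; apply/negbTE; apply: contra JnE => /forall_inP mg.
  by apply/subsetP => p /mg /andP[]; rewrite inE.
have [[u [w|]] /=] : exists2 p, spider_adj0 p.1 p.2 & p \notin J.
- have : ~~ ([set p | spider_adj0 p.1 p.2] \subset J).
    by apply: contra JE => EsJ; rewrite eqEsubset JsE.
  by case/subsetPn => p; rewrite inE; exists p.
- move=> uw nJ; apply: (turn_sum0 _ (A := subleg w) (i := ord0)).
  + exact: card_subleg.
  + by move=> *; exact: ord1.
  move=> f; apply: eq_forallb => -[x y]; case xyJ : ((x, y) \in J) => //=.
  have xy : spider_adj0 x y by have := subsetP JsE _ xyJ; rewrite inE.
  rewrite xy turn_eq //; apply: (subleg_edge uw xy).
  by apply: contraNneq nJ => <-.
by case: u.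
Qed.

(* Expanding the product of the [1 - [f x = f y]] over the edges leaves only the
   term of the full edge set: any other set of edges leaves a subleg free to be
   turned independently of the rest. *)
Lemma spider_top_neq0 :
  \sum_(f | proper_color (@spider_adj l) f && balanced mu1 (fun v => tag (f v)))
     \prod_v wt (f v) != 0.
Proof.
have bal f : balanced mu1 (fun v => tag (f v)).
  apply/forallP => i; apply/eqP; apply: eq_card => v.
  by rewrite inE; apply/eqP; rewrite !ord1.
set E := [set p : V * V | spider_adj0 p.1 p.2].
have -> : \sum_(f | proper_color (@spider_adj l) f && balanced mu1 (fun v => tag (f v)))
     \prod_v wt (f v) = (-1) ^+ #|E| * \sum_(f | merged E f) \prod_v wt (f v).
  rewrite (eq_bigl (proper_color (@spider_adj l))) => [|f]; last by rewrite bal andbT.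
  rewrite big_mkcond /=.
  rewrite (eq_bigr (fun f => \sum_(J : {set V * V})
      (-1) ^+ #|J| * (if merged J f then \prod_v wt (f v) else 0))) => [|f _]; last first.
    rewrite -mulrb -mulr_natr proper_spider_sum mulr_sumr; apply: eq_bigr => J _.
    by rewrite mulrCA mulr_natr mulrb.
  rewrite exchange_big (bigD1 E) //= [X in _ + X]big1 ?addr0 => [|J JE].
    by rewrite -mulr_sumr -big_mkcond.
  by rewrite -mulr_sumr -big_mkcond merged_sum0 ?mulr0.
rewrite mulf_neq0 ?signr_eq0 //.
rewrite (reindex_onto (fun c => [ffun=> c]) (fun f => f None)) => [|f /merged_all_const //].
rewrite (eq_bigl xpredT) => [|c]; last first.
  rewrite ffunE eqxx andbT; apply/forall_inP => p; rewrite inE => ->.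
  by rewrite !ffunE eqxx.
(* As [zeta ^+ n = 1], each of the [n] constant colourings contributes the same nonzero
   [om ^+ n]. *)
rewrite (eq_bigr (fun=> om mu1 ord0 ^+ #|V|)) => [|c _].
  rewrite sumr_const -mulr_natr mulf_neq0 //.
    by rewrite expf_neq0 //; apply: om_neq0 => _; exact: spider_vertex_gt0.
  by rewrite pnatr_eq0 card_color big_ord1 -lt0n spider_vertex_gt0.
rewrite (eq_bigr (fun=> wt c)) => [|v _]; last by rewrite ffunE.
rewrite prodr_const /weight exprMn -exprM mulnC exprM.
by rewrite (prim_expr_order (zetaP _ _)) expr1n mulr1 tag_color1.
Qed.

(* Blocks of size at least [m] cannot be contained in a leg of length less than
   [m], so the block of the center swallows all those legs. *)
Lemma center_part_ge (m k : nat) (mu : 'I_k -> nat) :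
  (0 < m)%N -> (forall i, m <= mu i)%N -> (\sum_i mu i)%N = #|V| ->
  e_positive (@spider_adj l) ->
  exists i, (1 + \sum_(q <- l | q < m) q <= mu i)%N.
Proof.
move=> m0 le_m_mu sum_mu epos.
have mu_gt0 i : (0 < mu i)%N by apply: leq_trans m0 (le_m_mu i).
have [/existsP//|small] := boolP [exists i, (1 + \sum_(q <- l | q < m) q <= mu i)%N].
case: (e_positive_no_split mu_gt0 sum_mu epos spider_top_neq0) => g /forallP bal.
pose leg (w : {i : 'I_(size l) & 'I_(nth 0%N l i)}) := nth 0%N l (tag w).
(* Otherwise the block of the center contains the center and all short legs, against [small]. *)
have [w lw gw] : exists2 w, (leg w < m)%N & g (Some w) != g None.
  apply/exists_inP; apply: contraNT small; rewrite negb_exists_in => /forall_inP same.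
  apply/existsP; exists (g None); rewrite -(eqP (bal (g None))).
  pose B : {set V} := [set x | if x is Some w then (leg w < m)%N else true].
  have BE : #|B| = (1 + \sum_(q <- l | q < m) q)%N.
    have -> : B = None |: Some @: [set w | (leg w < m)%N].
      apply/setP => -[w|]; rewrite !inE //.
      by apply/idP/imsetP => [lw|[w' + [->]]]; rewrite ?inE //; exists w; rewrite ?inE.
    rewrite cardsU1 card_imset; last by move=> ? ? [].
    have -> : None \notin (Some @: [set w | (leg w < m)%N] : {set V}) by apply/imsetP => -[].
    congr (_ + _)%N; rewrite -sum1_card.
    rewrite (big_nth 0%N) big_mkord.
    rewrite (eq_bigr (fun i : 'I_(size l) => \sum_(j < nth 0%N l i) 1)%N) => [|i _]; last first.
      by rewrite sum1_card card_ord.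
    rewrite [RHS](sig_big_dep (fun i : 'I_(size l) => nth 0%N l i < m)%N (fun _ => xpredT)).
    by apply: eq_bigl => w; rewrite inE andbT.
  rewrite -BE; apply: subset_leq_card; apply/subsetP => -[w|]; rewrite !inE //.
  by move/same/negPn.
(* The part of the block of [w] inside its leg has fewer than [m] vertices, and the leg is left only
   through the center, which is in another block. *)
exists (g (Some w)), [set x | if x is Some w' then
  (tag w' == tag w) && (g x == g (Some w)) else false]; split.
- apply/andP; split; first by apply/card_gt0P; exists (Some w); rewrite inE !eqxx.
  apply: leq_ltn_trans (leq_trans lw (le_m_mu _)).
  pose h (j : 'I_(nth 0%N l (tag w))) : V := Some (Tagged (fun i : 'I_(size l) => 'I_(nth 0%N l i)) j).
  rewrite -[leg w]card_ord -(card_image (f := h)); last first.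
    by move=> a b /Some_inj /eqP; rewrite eq_Tagged => /eqP.
  apply: subset_leq_card; apply/subsetP => -[[i j]|]; rewrite inE // => /andP[/= /eqP ij _].
  by case: _ / (esym ij) j => j; apply/imageP; exists j.
- by move=> [w'|]; rewrite inE // => /andP[_ /eqP].
move=> [u|] [v|] //; rewrite !inE //; last first.
  by move=> _ _ gN; rewrite gN eqxx in gw.
case/andP=> /eqP tu _ /negbTE nv gv; move: nv; rewrite gv eqxx andbT.
move=> nv; have uv : (tag u == tag v) = false by rewrite tu eq_sym.
by rewrite /spider_adj /= (eq_sym (tag v)) uv.
Qed.

Lemma e_positive_part_ge (m : nat) (s : seq nat) :
  (0 < m)%N -> all (leq m) s -> sumn s = (1 + sumn l)%N ->
  e_positive (@spider_adj l) ->
  exists2 x, x \in s & (1 + \sum_(q <- l | q < m) q <= x)%N.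
Proof.
move=> m0 /(all_nthP 0%N) ms sum_s epos.
have [||i hi] := @center_part_ge m (size s) (fun i => nth 0%N s i) m0 _ _ epos.
- by move=> i; apply: ms.
- by rewrite card_spider_vertex -sum_s sumnE (big_nth 0%N) big_mkord.
by exists (nth 0%N s i); rewrite // mem_nth.
Qed.

End Spider.

Local Close Scope ring_scope.

(** * Inequalities between leg lengths *)

Section LegLengths.

Variable l : seq nat.
Hypotheses (l_sorted : sorted geq l) (l_pos : all (fun x => 0 < x) l).
Hypothesis epos : e_positive (@spider_adj l).
Local Notation lam := (nth 0 l).

Lemma lam_le i j : i <= j -> j < size l -> lam j <= lam i.
Proof.
move=> ij jl; apply: (sorted_leq_nth (leT := geq)) => //; rewrite ?inE //.
- by move=> a b c /= ab bc; apply: leq_trans bc ab.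
- exact: leqnn.
exact: leq_ltn_trans ij jl.
Qed.

Lemma lam_gt0 i : i < size l -> 0 < lam i.
Proof. by move=> il; apply: (allP l_pos); rewrite mem_nth. Qed.

Lemma order_le_first_leg : 0 < size l -> 1 + sumn l <= 2 * lam 0 + 1.
Proof.
move=> l0; rewrite leqNgt; apply/negP => big_n.
(* Both parts exceed every leg, so one of them would have to hold the whole spider. *)
have [||||x] := @e_positive_part_ge l (lam 0).+1
  [:: (lam 0).+1; 1 + sumn l - (lam 0).+1] => //.
- by rewrite /= andbT; apply/andP; split; lia.
- by rewrite /=; lia.
have -> : \sum_(q <- l | q < (lam 0).+1) q = sumn l.
  rewrite sumnE big_seq_cond [RHS]big_seq; apply: eq_bigl => q.
  apply: andb_idr => /(nthP 0) [i il <-]; rewrite ltnS; exact: lam_le.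
by rewrite !inE => /orP[] /eqP ->; lia.
Qed.

(** Greedy choice: each term takes as much of the remainder as [b] allows. *)
Lemma bounded_composition k b r : r <= k * b ->
  exists s, [/\ size s = k, all (fun x => x <= b) s & sumn s = r].
Proof.
elim: k r => [|k IH] r rk; first by exists [::]; split => //=; lia.
have [|s [sz sb sr]] := IH (r - minn r b); first by rewrite mulSn in rk; lia.
by exists (minn r b :: s); split; rewrite /= ?sz ?sb ?sr; lia.
Qed.

(* Otherwise [n] is a sum of parts between [lam p + 1] and [lam p + 1 + lam p.+1],
   none of which can hold the center and the legs [p], [p.+1], [p.+2]. *)
Lemma leg_growth p : 0 < p -> p.+2 < size l ->
  (1 + sumn l) * lam p.+1 < 2 * lam p ^ 2.
Proof.
move=> p0 pl; set a := lam p; set b := lam p.+1; set n := 1 + sumn l.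
have a_gt0 : 0 < a by apply: lam_gt0; lia.
have c_gt0 : 0 < lam p.+2 by apply: lam_gt0.
have sum_drop : sumn l = sumn (take p l) + sumn (drop p l).
  by rewrite -sumn_cat cat_take_drop.
have dropE : drop p l = [:: a, b, lam p.+2 & drop p.+3 l].
  by rewrite (drop_nth 0) 1?(drop_nth 0 (n := p.+1)) 1?(drop_nth 0 (n := p.+2)) //; lia.
have n_ge : 1 + 2 * a <= n.
  have : lam 0 <= sumn (take p l).
    by case: (l) p0 => [|x s]; case: (p) => //= q _; lia.
  have : a <= lam 0 by apply: lam_le; lia.
  by rewrite /n sum_drop dropE /=; lia.
have smallS : a + b + lam p.+2 <= \sum_(q <- l | q < a.+1) q.
  have ab : b <= a by apply: lam_le; lia.
  have ac : lam p.+2 <= a by apply: lam_le; lia.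
  have -> : \sum_(q <- l | q < a.+1) q = \sum_(q <- take p l ++ drop p l | q < a.+1) q.
    by rewrite cat_take_drop.
  rewrite big_cat dropE !big_cons !ltnS leqnn ab ac /=.
  by rewrite -!addnA; lia.
pose k := n %/ a.+1; pose r := n %% a.+1.
have nE : n = k * a.+1 + r by apply: divn_eq.
have ra : r <= a by rewrite -ltnS ltn_pmod.
have kb : k * b < r.
  (* If [r <= k * b], the remainder is spread over [k] parts [a.+1], adding at most [b] to each; all
     parts stay below [1 + a + b + lam p.+2]. *)
  rewrite ltnNge; apply/negP => /bounded_composition [s [sz sb sr]].
  have [||||x] := @e_positive_part_ge l a.+1 (map (addn a.+1) s) => //.
  - by apply/allP => _ /mapP[y _ ->]; apply: leq_addr.
  - rewrite -/n nE -sr -sz; elim: (s) => //= y t IH; rewrite IH; lia.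
  case/mapP=> y /(allP sb) yb -> ; lia.
(* [n_ge] forces [k >= 1], so [b < a]; then [n * b = k * b * (a + 1) + r * b <= (a - 1) * (a + 1) +
   a * b < 2 * a ^ 2]. *)
nia.
Qed.

End LegLengths.

(** The sum runs backwards over all legs but the first and the last two, and the first alone has at
    least half of the [sumn l] leg vertices. *)
Lemma middle_legs_lt (l : seq nat) : 0 < size l -> 1 + sumn l <= 2 * nth 0 l 0 + 1 ->
  2 * (\sum_(1 <= k < size l - 2) nth 0 l (size l - 2 - k)) < 1 + sumn l.
Proof.
move=> l0 first_leg; rewrite big_nat_rev /=.
have -> : \sum_(1 <= k < size l - 2) nth 0 l (size l - 2 - (1 + (size l - 2) - k.+1))
   = \sum_(1 <= k < size l - 2) nth 0 l k.
  by apply: eq_big_nat => k k_lt; congr nth; lia.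
suff : nth 0 l 0 + \sum_(1 <= k < size l - 2) nth 0 l k <= sumn l by lia.
rewrite [X in _ <= X]sumnE [X in _ <= X](big_nth 0) [X in _ <= X]big_ltn // leq_add2l.
case: (ltnP 1 (size l - 2)) => [l3|l3]; last by rewrite [X in X <= _]big_geq.
by rewrite [X in _ <= X](@big_cat_nat _ _ _ (size l - 2)) ?leq_addr //; lia.
Qed.

(** * Real estimates *)

Section RealBounds.

Local Open Scope R_scope.

Lemma leg_lower_bound (N : R) (L : nat -> R) (K : nat) :
  0 < N -> 1 <= L 0%N -> (forall k, (k <= K)%N -> 0 <= L k) ->
  (forall k, (k < K)%N -> N * L k <= L k.+1 * L k.+1) ->
  forall k, (k <= K)%N -> N * Rpower N (- / 2 ^ k) <= L k.
Proof.
move=> N0 L0 Lge0 step; elim=> [|k IH] kK.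
  by rewrite pow_O Rinv_1 Rpower_Ropp Rpower_1 // Rinv_r; lra.
set u := Rpower N (- / 2 ^ k.+1).
have u0 : 0 < u by apply: exp_pos.
(* Halving the exponent takes a square root: [(N * u) ^ 2 = N * (N * u ^ 2) <= N * L k], and [step]
   bounds this by the square of [L k.+1]. *)
have uu : Rpower N (- / 2 ^ k) = u * u.
  rewrite /u -Rpower_plus; congr Rpower; rewrite -tech_pow_Rmult.
  by field; apply: pow_nonzero; lra.
have := IH (ltnW kK); have := step k kK; rewrite uu => h1 h2.
apply: Rsqr_incr_0; rewrite /Rsqr; [nra | nra | exact: Lge0].
Qed.

Lemma sum_le_INR (s : seq nat) (F : nat -> R) (G : nat -> nat) (N : R) :
  (forall k, k \in s -> F k <= INR (G k) / N) ->
  \big[Rplus/0]_(k <- s) F k <= INR (\sum_(k <- s) G k)%N / N.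
Proof.
elim: s => [|k s IH] FG; first by rewrite !big_nil /= /Rdiv Rmult_0_l; lra.
rewrite !big_cons plus_INR Rdiv_plus_distr; apply: Rplus_le_compat.
  by apply: FG; rewrite inE eqxx.
by apply: IH => j js; apply: FG; rewrite inE js orbT.
Qed.

Lemma spider_lhs_lt1 (n d : nat) (lam : nat -> nat) :
  (0 < n)%N -> (2 < d)%N -> (0 < lam (d - 2))%N ->
  (forall p, 0 < p -> p.+2 < d -> n * lam p.+1 < 2 * lam p ^ 2)%N ->
  (2 * (\sum_(1 <= k < d - 2) lam (d - 2 - k)) < n)%N ->
  spider_lhs n d < 1.
Proof.
move=> n0 d2 lam0 growth mid; rewrite /spider_lhs; set N := INR n / INR 2.
have INR2 : INR 2 = 2 by [].
have nN : INR n = 2 * N by rewrite /N INR2; field.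
have N0 : 0 < N by move/ssrnat.ltP/lt_0_INR: n0; rewrite nN; lra.
(* The chain starts at [d - 2], the last index that [growth] reaches, and descends to index 1 at
   [k = d - 3]. *)
pose L k := INR (lam (d - 2 - k)%N).
have bound k : (k <= d - 3)%N -> N * Rpower N (- / 2 ^ k) <= L k.
  apply: (leg_lower_bound N0) => {k} [|k _|k kd].
  - by apply: (le_INR 1); apply/ssrnat.leP; rewrite subn0.
  - exact: pos_INR.
  rewrite /L; set p := (d - 2 - k.+1)%N.
  have -> : (d - 2 - k)%N = p.+1 by lia.
  have : (n * lam p.+1 < 2 * lam p ^ 2)%N by apply: growth; lia.
  move/ssrnat.ltP/lt_INR; rewrite -mulnn !mult_INR INR2 nN; lra.
apply: (Rle_lt_trans _ (INR (\sum_(1 <= k < d - 2) lam (d - 2 - k))%N / N)).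
  apply: sum_le_INR => k; rewrite mem_index_iota => kd.
  apply: (Rmult_le_reg_l N) => //; rewrite INR2.
  have -> : N * (INR (lam (d - 2 - k)%N) / N) = L k by rewrite /L; field; lra.
  by apply: bound; lia.
apply: (Rmult_lt_reg_r N) => //.
move/ssrnat.ltP/lt_INR: mid; rewrite mult_INR INR2 nN => mid.
by rewrite /Rdiv Rmult_assoc Rinv_l; lra.
Qed.

End RealBounds.

Theorem theorem3p9 (l : seq nat) :
  sorted geq l ->
  all (fun x => 0 < x) l ->
  5 <= size l ->
  e_positive (@spider_adj l) ->
  Rlt (spider_lhs (1 + sumn l) (size l)) R1.
Proof.
move=> l_sorted l_pos l5 epos; apply: (spider_lhs_lt1 (lam := nth 0 l)) => //.
- exact: ltn_trans l5.
- by apply: lam_gt0 => //; lia.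
- exact: leg_growth.
by apply: middle_legs_lt; [lia | apply: (order_le_first_leg l_sorted l_pos epos); lia].
Qed.
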